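(* Let $G$ be a connected graph on $n \ge 3$ vertices which is not isomorphic to the cycle $C_5$. Then $\iota(G) \le \frac{n}{3}$. Moreover, this bound is sharp, i.e. there exist such graphs $G$ with $\iota(G) = \frac{n}{3}$.
   Context: All graphs are finite, simple and undirected. For a set $S \subseteq V(G)$, $N[S]$ denotes the closed neighborhood of $S$: $S$ together with all vertices having a neighbor in $S$. A set $S \subseteq V(G)$ is isolating if $V(G)\setminus N[S]$ is an independent set (possibly empty). The isolation number $\iota(G)$ is the minimum cardinality of an isolating set of $G$ (the empty set is allowed). *)

(* Defs.v *)
From mathcomp Require Import all_boot all_order all_algebra.

Set Implicit Arguments.
Unset Strict Implicit.
Unset Printing Implicit Defensive.

Record sgraph := SGraph {
  vertex :> finType;
  adj : rel vertex;
  adj_sym : symmetric adj;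
  adj_irrefl : irreflexive adj
}.

Definition connected_graph (G : sgraph) : Prop :=
  forall x y : G, connect (@adj G) x y.

Definition isomorphic (G H : sgraph) : Prop :=
  exists f : G -> H, bijective f /\ forall x y : G, adj (f x) (f y) = adj x y.

(* [ordS] is the successor modulo n. The conjunct [i != j] only matters for
   n = 1, where it removes the loop. *)
Definition cycle_adj (n : nat) : rel 'I_n :=
  fun i j => (i != j) && ((j == ordS i) || (i == ordS j)).

Fact cycle_adj_sym (n : nat) : symmetric (@cycle_adj n).
Proof. by move=> i j; rewrite /cycle_adj eq_sym orbC. Qed.

Fact cycle_adj_irrefl (n : nat) : irreflexive (@cycle_adj n).
Proof. by move=> i; rewrite /cycle_adj eqxx. Qed.

Definition cycle_graph (n : nat) : sgraph :=
  SGraph (@cycle_adj_sym n) (@cycle_adj_irrefl n).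

Section Isolation.

Variable G : sgraph.
Implicit Types S A : {set G}.

Definition closed_nbhd S : {set G} :=
  [set x | (x \in S) || [exists y in S, adj x y]].

Definition independent A : bool :=
  [forall x in A, forall y in A, ~~ adj x y].

Definition isolating S : bool := independent (~: closed_nbhd S).

(* [arg min] returns a minimizer only when its default value satisfies the
   predicate. *)
Fact isolating_setT : isolating [set: G].
Proof. by apply/forall_inP=> x; rewrite !inE. Qed.

Definition isolation_number : nat :=
  #|[arg min_(S < [set: G] | isolating S) #|S|]|.

End Isolation.

(* Main.v *)
(* Take a path [r :: s] in [G] that cannot be prolonged. Either it closes up to a
   Hamiltonian cycle, or all neighbours of [r] lie on it and its other end is not
   one of them. In the second case extend the path to a depth-first search tree
   rooted at [r]: its leaves are pairwise non-adjacent, and no leaf is adjacent to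
   [r]. A vertex that is neither a leaf nor [r] has a parent and a child, so it is
   dominated by each of the three classes of vertices of given depth modulo 3.
   Hence these three disjoint sets are isolating, and one has size at most n/3.
   On a Hamiltonian cycle v_0, v_1, ..., every third vertex works unless
   n = 3m + 2. If then n >= 8, one can leave just v_2 and v_6 undominated, which is
   fine unless they are adjacent; if v_2 v_6 and its shift v_4 v_8 are both chords,
   these dominate enough vertices for m vertices to suffice. If n = 5, G has a
   chord, and either end of it dominates all vertices but one. *)
Require Import Defs.
From mathcomp Require Import all_boot all_order all_algebra zify.

Set Implicit Arguments.
Unset Strict Implicit.
Unset Printing Implicit Defensive.

Import Order.TTheory GRing.Theory Num.Theory.
Local Open Scope ring_scope.

Section Bound.

Local Open Scope nat_scope.

Variable G : sgraph.
Implicit Types (A B L S : {set G}) (a x y z r : G) (s : seq G).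

(** * Isolating sets from dominated vertices *)

Definition third_isolating : Prop := exists S, isolating S /\ 3 * #|S| <= #|G|.

Lemma isolation_number_le S : isolating S -> isolation_number G <= #|S|.
Proof.
rewrite /isolation_number => isoS.
by case: arg_minnP => [|T _ minT]; [exact: isolating_setT | exact: minT].
Qed.

Lemma mem_closed_nbhd S x y : y \in S -> (x == y) || adj x y -> x \in closed_nbhd S.
Proof.
move=> Sy /orP[/eqP-> | xy]; rewrite inE ?Sy //.
by apply/orP; right; apply/exists_inP; exists y.
Qed.

Lemma isolatingW S A :
  independent A -> (forall x, x \notin A -> x \in closed_nbhd S) -> isolating S.
Proof.
move=> indA domS; have sub x : x \in ~: closed_nbhd S -> x \in A.
  by rewrite in_setC; apply: contraR => /domS.
apply/forall_inP=> x /sub Ax; apply/forall_inP=> y /sub Ay.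
by move/forall_inP: indA => /(_ x Ax)/forall_inP/(_ y Ay).
Qed.

Lemma independent_pair x y : ~~ adj x y -> independent [set x; y].
Proof.
move=> nxy; apply/forall_inP=> u /set2P[]->; apply/forall_inP=> v /set2P[]-> //.
- by rewrite adj_irrefl.
- by rewrite adj_sym.
- by rewrite adj_irrefl.
Qed.

(** * Depth-first search trees *)

(* A depth-first search tree rooted at [a], spanning the component [B] of [a] in
   the subgraph induced by [A], whose first branch starts with [a :: s]; [L] is
   the set of its leaves and [c] the depth, shifted by [k]. *)
Record dfs_tree A a s k B L (c : G -> nat) : Prop := DfsTree {
  dfs_sub : B \subset A;
  dfs_branch : {subset a :: s <= B};
  dfs_closed : forall x y, x \in B -> y \in A -> adj x y -> y \in B;
  dfs_root : c a = k;
  dfs_parent : forall x, x \in B -> x != a ->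
    exists y, [/\ y \in B, adj x y & c x = (c y).+1];
  dfs_child : forall x, x \in B -> x \notin L ->
    exists y, [/\ y \in B, adj x y & c y = (c x).+1];
  dfs_leaves_sub : L \subset B;
  dfs_leaves : independent L;
  dfs_branch_leaf : forall x, x \in a :: s -> x \in L -> x = last a s
}.

(** Induction on the size of [A]: one tree, rooted at a child [a1], spans the component [B1] of [a1]
    in [A :\ a]; a second, rooted at [a], spans its component in [A :\: B1]; the edge between [a]
    and [a1] joins them. Taking [a1] from the head of [s] makes the given path a branch. *)
Lemma dfs_tree_exists A a s k :
    a \in A -> path (@adj G) a s -> uniq (a :: s) -> {subset s <= A} ->
  exists B L c, dfs_tree A a s k B L c.
Proof.
have [n] := ubnP #|A|; elim: n => // n IHn in A a s k *.
rewrite ltnS => leAn Aa.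
have step a1 s1 : adj a a1 -> a1 \in A -> path (@adj G) a1 s1 ->
    uniq [:: a, a1 & s1] -> {subset s1 <= A} ->
    exists B L c, dfs_tree A a (a1 :: s1) k B L c.
  move=> aa1 Aa1 pth; rewrite cons_uniq => /andP[s1'a uq] sA.
  have [|||B1 [L1 [c1 T1]]] // := IHn (A :\ a) a1 s1 k.+1 _ _ pth uq.
  - by rewrite (cardsD1 a A) Aa in leAn.
  - rewrite !inE Aa1 andbT; apply: contraNneq s1'a => ->; exact: mem_head.
  - move=> x s1x; rewrite !inE sA // andbT; apply: contraNneq s1'a => <-.
    by rewrite inE s1x orbT.
  have B1a1 : a1 \in B1 by apply: (dfs_branch T1); exact: mem_head.
  have B1'a : a \notin B1.
    by apply/negP=> /(subsetP (dfs_sub T1)); rewrite !inE eqxx.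
  have [|||||B2 [L2 [c2 T2]]] // := IHn (A :\: B1) a [::] k.
  - apply: leq_trans leAn; apply: proper_card; rewrite properE subsetDl /=.
    by apply/subsetPn; exists a1; rewrite // inE B1a1.
  - by rewrite inE B1'a.
  have B2a : a \in B2 by apply: (dfs_branch T2); exact: mem_head.
  have B2'1 x : x \in B2 -> (x \in B1) = false.
    by move/(subsetP (dfs_sub T2)); rewrite inE => /andP[/negbTE].
  (* [a] may be a leaf of the second tree, but after joining it has the child [a1]. *)
  exists (B1 :|: B2), (L1 :|: L2 :\ a), (fun x => if x \in B1 then c1 x else c2 x).
  split.
  - rewrite subUset (subset_trans (dfs_sub T1)) ?subsetDl //.
    by rewrite (subset_trans (dfs_sub T2)) ?subsetDl.
  - move=> x; rewrite inE => /predU1P[-> | /(dfs_branch T1) B1x].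
      by rewrite inE B2a orbT.
    by rewrite inE B1x.
  - move=> x y /setUP[B1x | B2x] Ay xy; rewrite inE.
      have [-> | nya] := eqVneq y a; first by rewrite B2a orbT.
      by rewrite (dfs_closed T1 B1x _ xy) // !inE nya.
    have [// | B1'y /=] := boolP (y \in B1).
    by rewrite (dfs_closed T2 B2x _ xy) // inE B1'y.
  - by rewrite (negbTE B1'a) (dfs_root T2).
  - move=> x; rewrite in_setU; case: (boolP (x \in B1)) => /= [B1x _ _ | B1'x B2x nxa].
      have [-> | nxa1] := eqVneq x a1.
        exists a; rewrite (negbTE B1'a) in_setU B2a orbT (dfs_root T1) (dfs_root T2).
        by rewrite adj_sym.
      have [y [B1y xy cy]] := dfs_parent T1 B1x nxa1.
      by exists y; rewrite inE B1y.
    have [y [B2y xy cy]] := dfs_parent T2 B2x nxa.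
    by exists y; rewrite inE B2y orbT B2'1.
  - move=> x; rewrite in_setU; case: (boolP (x \in B1)) => /= [B1x _ | B1'x B2x] L'x.
      have [|y [B1y xy cy]] := dfs_child T1 B1x.
        by apply: contra L'x => L1x; rewrite inE L1x.
      by exists y; rewrite inE B1y.
    have [-> | nxa] := eqVneq x a.
      by exists a1; rewrite in_setU B1a1 (dfs_root T1) (dfs_root T2).
    have [|y [B2y xy cy]] := dfs_child T2 B2x.
      by apply: contra L'x => L2x; rewrite !inE L2x nxa orbT.
    by exists y; rewrite inE B2y orbT B2'1.
  - rewrite setUSS ?(dfs_leaves_sub T1) //.
    by rewrite (subset_trans _ (dfs_leaves_sub T2)) ?subsetDl.
  (* [B1] is closed under adjacency in [A :\ a], so its only edges to the second tree end at [a]. *)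
  - have cross x y : x \in L1 -> y \in L2 :\ a -> ~~ adj x y.
      move=> L1x /setD1P[nya L2y]; apply/negP=> xy.
      have B1x := subsetP (dfs_leaves_sub T1) _ L1x.
      have B2y := subsetP (dfs_leaves_sub T2) _ L2y.
      have /setDP[Ay /negP[]] := subsetP (dfs_sub T2) _ B2y.
      by apply: (dfs_closed T1 B1x _ xy); rewrite !inE nya.
    apply/forall_inP=> x Lx; apply/forall_inP=> y Ly.
    case/setUP: Lx Ly => Lx /setUP[] Ly; [| exact: cross | |].
    + by move/forall_inP: (dfs_leaves T1) => /(_ x Lx)/forall_inP/(_ y Ly).
    + by rewrite adj_sym cross.
    + case/setD1P: Lx Ly => _ Lx /setD1P[_ Ly].
      by move/forall_inP: (dfs_leaves T2) => /(_ x Lx)/forall_inP/(_ y Ly).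
  - move=> x; rewrite inE => /predU1P[-> | s1x].
      rewrite !inE eqxx /= orbF => /(subsetP (dfs_leaves_sub T1)).
      by rewrite (negbTE B1'a).
    case/setUP=> [/(dfs_branch_leaf T1 s1x) // | /setD1P[_]].
    move/(subsetP (dfs_leaves_sub T2))/B2'1.
    by rewrite (dfs_branch T1 s1x).
case: s => [_ _ _ | a1 s1 /= /andP[aa1 pth] uq sA]; last first.
  by apply: step => // [|x s1x]; apply: sA; rewrite inE ?eqxx ?s1x ?orbT.
(* For empty [s], any neighbour of [a] in [A] can start the first branch; if there is none, [a]
   alone is the tree. *)
have [/exists_inP[a1 Aa1 aa1] | /exists_inPn nbr0] := boolP [exists y in A, adj a y].
  have [|||||B [L [c T]]] // := step a1 [::].
    by rewrite /= inE andbT; apply: contraTneq aa1 => ->; rewrite adj_irrefl.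
  exists B, L, c; case: T => ? br ? ? ? ? ? ? _; split=> // x.
    by rewrite inE => /eqP->; apply: br; exact: mem_head.
  by rewrite inE => /eqP.
exists [set a], [set a], (fun=> k); split=> //.
- by rewrite sub1set.
- by move=> x; rewrite !inE.
- by move=> x y /set1P-> /nbr0/negbTE->.
- by move=> x /set1P->; rewrite eqxx.
- by move=> x ->.
- by rewrite -[[set a]]setUid independent_pair // adj_irrefl.
- by move=> x _ /set1P.
Qed.

(** * Depth classes modulo 3 *)

Lemma connected_closed_set A x :
  connected_graph G -> x \in A -> (forall y z, y \in A -> adj y z -> z \in A) ->
  A = setT.
Proof.
move=> conn Ax clA; apply/setP=> y; rewrite inE.
case/connectP: (conn x y) => p + ->.
by elim: p x Ax => //= z p IHp x Ax /andP[/clA-/(_ Ax)]; apply: IHp.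
Qed.

Lemma third_class (c : G -> nat) :
  (forall i, i < 3 -> isolating [set x | c x %% 3 == i]) -> third_isolating.
Proof.
pose D i := [set x | c x %% 3 == i] => isoD.
have cardD : #|D 0| + #|D 1| + #|D 2| <= #|G|.
  have disjD i j : i != j -> #|D i :|: D j| = #|D i| + #|D j|.
    move=> nij; apply/eqP; rewrite (leq_card_setU _ _).2.
    by rewrite disjoint_subset; apply/subsetP=> x; rewrite !inE => /eqP->.
  rewrite -disjD //; have/eqP <- : #|(D 0 :|: D 1) :|: D 2| == #|D 0 :|: D 1| + #|D 2|.
    rewrite (leq_card_setU _ _).2 disjoint_subset; apply/subsetP=> x.
    by rewrite !inE => /orP[] /eqP->.
  exact: max_card.
have [le0 | lt0] := leqP (3 * #|D 0|) #|G|.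
  by exists (D 0); split; first exact: isoD.
have [le1 | lt1] := leqP (3 * #|D 1|) #|G|.
  by exists (D 1); split; first exact: isoD.
by exists (D 2); split; [exact: isoD | lia].
Qed.

Lemma third_of_path r s :
    connected_graph G -> path (@adj G) r s -> uniq (r :: s) ->
    (forall x, adj r x -> x \in r :: s) -> ~~ adj r (last r s) ->
  third_isolating.
Proof.
move=> conn pth uq nbr_r end_r.
have [B [L [c T]]] := dfs_tree_exists 0 (in_setT r) pth uq (fun x _ => in_setT x).
have BT : B = setT.
  apply: (connected_closed_set (x := r)) => // [|x y Bx].
    by apply: (dfs_branch T); exact: mem_head.
  exact: (dfs_closed T Bx (in_setT y)).
(* Neighbours of [r] lie on the first branch, whose only possible leaf is its end, and that end is
   not adjacent to [r]. *)
have nrL x : x \in L -> ~~ adj r x.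
  move=> Lx; apply/negP=> rx.
  by move: (rx); rewrite (dfs_branch_leaf T (nbr_r _ rx) Lx) (negbTE end_r).
apply: (third_class (c := c)) => i lt_i3.
apply: (isolatingW (A := r |: L)).
  apply/forall_inP=> x /setU1P[-> | Lx]; apply/forall_inP=> y /setU1P[-> | Ly].
  - by rewrite adj_irrefl.
  - exact: nrL.
  - by rewrite adj_sym nrL.
  - by move/forall_inP: (dfs_leaves T) => /(_ x Lx)/forall_inP/(_ y Ly).
move=> x; rewrite in_setU1 negb_or => /andP[nxr L'x].
have Bx : x \in B by rewrite BT.
have [y [_ xy cy]] := dfs_parent T Bx nxr.
have [z [_ xz cz]] := dfs_child T Bx L'x.
have [/eqP ci | nx] := boolP (c x %% 3 == i).
  by apply: (mem_closed_nbhd (y := x)); rewrite ?inE ?ci ?eqxx.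
have [/eqP ci | ny] := boolP (c y %% 3 == i).
  by apply: (mem_closed_nbhd (y := y)); rewrite ?inE ?ci ?eqxx ?xy ?orbT.
by apply: (mem_closed_nbhd (y := z)); rewrite ?inE ?xz ?orbT //; lia.
Qed.

(** * Hamiltonian cycles and how they arise *)

(** A Hamiltonian cycle as a periodic sequence, so that indices may run past n without reduction. *)
Definition hamiltonian_walk (f : nat -> G) : Prop :=
  [/\ forall i, adj (f i) (f i.+1), forall i, f (i + #|G|) = f i &
      forall x, exists2 i, i < #|G| & x = f i].

Lemma hamiltonian_walk_of_cycle s :
  cycle (@adj G) s -> uniq s -> size s = #|G| -> 0 < #|G| -> exists f, hamiltonian_walk f.
Proof.
move=> cyc uq sz n0.
have allS x : x \in s.
  have -> : x \in s = (x \in [set y in s]) by rewrite inE.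
  have -> : [set y in s] = setT.
    by apply/eqP; rewrite eqEcard subsetT cardsT -sz cardsE (card_uniqP uq) /=.
  by rewrite inE.
have [x0 _] : exists x0 : G, true by case/card_gt0P: n0 => x0; exists x0.
have fcyc := cycle_next uq.
have ord : order (next s) x0 = #|G| by rewrite (order_cycle fcyc uq (allS x0)).
exists (fun i => iter i (next s) x0); split=> [i | i | x].
- exact: (next_cycle cyc (allS _)).
- by rewrite iterD -ord (iter_order_cycle fcyc (allS x0) (allS x0)).
- have x0x : fconnect (next s) x0 x by rewrite (fconnect_cycle fcyc (allS x0)).
  by exists (findex (next s) x0 x); rewrite ?iter_findex // -ord findex_max.
Qed.

(** A path is prolonged at its head as long as possible. If its ends are then adjacent but it misses
    a vertex, connectedness gives an edge leaving the cycle, and opening the cycle there yields a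
    longer path. *)
Lemma third_or_hamiltonian :
  connected_graph G -> 2 < #|G| -> third_isolating \/ exists f, hamiltonian_walk f.
Proof.
move=> conn n3.
have [r _] : exists r : G, true by case/card_gt0P: (ltnW (ltnW n3)) => r; exists r.
suff longer m s x : #|G| - size s < m -> path (@adj G) x s -> uniq (x :: s) ->
    third_isolating \/ exists f, hamiltonian_walk f.
  by apply: (longer #|G|.+1 [::] r); rewrite //= ltnS leq_subr.
elim: m s x => // m IHm s {}r; rewrite ltnS => le_m pth uq.
have [/existsP[y /andP[ry s'y]] | /existsPn nbr] :=
  boolP [exists y, adj r y && (y \notin r :: s)].
  apply: (IHm (r :: s) y); last by rewrite cons_uniq s'y.
    by move: (card_uniqP uq) (max_card (mem (r :: s))) => /= -> lt_s; rewrite subnSK.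
  by rewrite /= adj_sym ry.
have [cyc | nlast] := boolP (adj r (last r s)); last first.
  left; apply: (third_of_path conn pth uq) => // x rx.
  by move: (nbr x); rewrite rx negbK.
have {}cyc : cycle (@adj G) (r :: s) by rewrite /= rcons_path pth adj_sym.
have [/eqP full | nfull] := boolP (size (r :: s) == #|G|).
  by right; apply: (hamiltonian_walk_of_cycle cyc uq full); lia.
have [u [z [su uz s'z]]] : exists u z, [/\ u \in r :: s, adj u z & z \notin r :: s].
  have [/exists_inP[u su /existsP[z /andP[uz s'z]]] | /exists_inPn cl] :=
    boolP [exists u in [set x in r :: s], [exists z, adj u z && (z \notin r :: s)]].
    by exists u, z; split=> //; rewrite inE in su.
  case/negP: nfull; rewrite -(card_uniqP uq) -cardsE.
  suff -> : [set x in r :: s] = setT by rewrite cardsT.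
  apply: (connected_closed_set (x := r)) => // [|y z sy yz].
    by rewrite inE mem_head.
  by move: (cl y sy) => /existsPn/(_ z); rewrite yz negbK inE.
(* Rotate the cycle to start at [u], drop its closing edge and put [z] in front. *)
have [i t rot_s] := rot_to su.
apply: (IHm (u :: t) z).
- move: (card_uniqP uq) (max_card (mem (r :: s))) (size_rot i (r :: s)).
  by rewrite rot_s => -> /= + [->] => lt_s; rewrite subnSK.
- rewrite /= adj_sym uz /=; move: cyc; rewrite -(rot_cycle i) rot_s /= rcons_path.
  by case/andP.
- by rewrite cons_uniq -rot_s mem_rot s'z rot_uniq.
Qed.

(** * Domination along a Hamiltonian walk *)

Definition dominates (f : nat -> G) (I : seq nat) i : Prop :=
  exists2 j, j \in I & (f i == f j) || adj (f i) (f j).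

Definition progression k q : seq nat := [seq k + 3 * t | t <- iota 0 q].

Lemma hamiltonian_walk_shift f k :
  hamiltonian_walk f -> hamiltonian_walk (fun i => f (i + k)).
Proof.
case=> fS fn fsurj; split=> [i | i | x]; first exact: fS.
  by rewrite addnAC fn.
have [i lt_in ->] := fsurj x.
have fmod j q : f (j + q * #|G|) = f j.
  by elim: q => [|q IHq]; rewrite ?mul0n ?addn0 // mulSnr addnA fn.
have n0 : 0 < #|G| by lia.
(* [k * #|G|.-1] is congruent to [-k] modulo n, so shifting by [k] leads back to [i]. *)
exists ((i + k * #|G|.-1) %% #|G|); first exact: ltn_pmod.
rewrite -(fmod (_ %% _ + k) ((i + k * #|G|.-1) %/ #|G|)) -(fmod i k).
congr f; have := divn_eq (i + k * #|G|.-1) #|G|.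
by rewrite -[in k * #|G|](prednK n0) mulnS; lia.
Qed.

(** Only [f a] and [f b] may stay undominated; [a = b] serves for a single exception. *)
Lemma third_of_dominates f I (a b : nat) :
    hamiltonian_walk f -> 3 * size I <= #|G| -> ~~ adj (f a) (f b) ->
    (forall i, i < #|G| -> [\/ dominates f I i, i = a | i = b]) ->
  third_isolating.
Proof.
move=> [_ _ fsurj] leI nab dom; exists [set x in map f I]; split.
  apply: (isolatingW (independent_pair nab)) => x.
  rewrite !inE negb_or => /andP[nxa nxb].
  have [i lt_in def_x] := fsurj x; rewrite def_x in nxa nxb *.
  case: (dom i lt_in) => [[j Ij ij] | ia | ib]; last 2 first.
  - by rewrite ia eqxx in nxa.
  - by rewrite ib eqxx in nxb.
  move: (@mem_closed_nbhd [set x in map f I] (f i) (f j)).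
  by rewrite !inE map_f //; apply.
apply: leq_trans leI; rewrite leq_mul2l /= cardsE.
by rewrite (leq_trans (card_size _)) ?size_map.
Qed.

Section HamiltonianWalk.

Variable f : nat -> G.
Hypothesis walk_f : hamiltonian_walk f.

(** The last alternative wraps around: [i] comes just before [j + n], and [f] has period n. *)
Lemma dominates_near I i j :
  j \in I -> [|| i == j, i == j.+1, i.+1 == j | i.+1 == j + #|G|] -> dominates f I i.
Proof.
have [fS fn _] := walk_f => Ij ij; exists j => //.
case/or4P: ij => /eqP => [-> | -> | <- | ij].
- by rewrite eqxx.
- by rewrite adj_sym fS orbT.
- by rewrite fS orbT.
- by rewrite -(fn j) -ij fS orbT.
Qed.

Lemma dominates_sub I J i : {subset I <= J} -> dominates f I i -> dominates f J i.
Proof. by move=> sIJ [j /sIJ]; exists j. Qed.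

(** Each term dominates itself and its two neighbours on the walk, so [q] terms cover [3 * q]
    consecutive indices from [k - 1] on. Writing [i.+1] avoids this subtraction at [k = 0]. *)
Lemma dominates_progression k q i :
  k <= i.+1 -> i.+1 < k + 3 * q -> dominates f (progression k q) i.
Proof.
move=> le_ki lt_iq; apply: (@dominates_near _ _ (k + 3 * ((i.+1 - k) %/ 3))).
  by apply: map_f; rewrite mem_iota; lia.
have := divn_eq (i.+1 - k) 3; lia.
Qed.

Lemma size_progression k q : size (progression k q) = q.
Proof. by rewrite size_map size_iota. Qed.

(** The multiples of 3 below [3 * m] cover all indices up to [3 * m - 2]. Index [3 * m - 1] is the
    exception; index [3 * m], below n only if n = 3m + 1, is then the last one and adjacent to index
    0. *)
Lemma third_of_walk_mod3 : 2 < #|G| -> #|G| %% 3 < 2 -> third_isolating.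
Proof.
move=> n3 n2; set m := #|G| %/ 3; have := divn_eq #|G| 3 => def_n.
apply: (@third_of_dominates f (progression 0 m) (3 * m).-1 (3 * m).-1) => //.
- by rewrite size_progression; lia.
- by rewrite adj_irrefl.
move=> i lt_in.
have [lt_i | ge_i] := ltnP i.+1 (3 * m).
  by apply: Or31; apply: dominates_progression.
have [-> | ni] := eqVneq i (3 * m).-1; first exact: Or32.
apply: Or31; apply: (@dominates_near _ _ 0); last by lia.
by apply: (@map_f _ _ (fun t => 0 + 3 * t) _ 0); rewrite mem_iota; lia.
Qed.

(* The undominated vertices are [f 2] and [f 6]. *)
Lemma third_of_walk_nonadj m :
  #|G| = 3 * m + 8 -> ~~ adj (f 2) (f 6) -> third_isolating.
Proof.
move=> def_n n26.
apply: (third_of_dominates (I := [:: 0, 4 & progression 8 m])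
  (a := 2) (b := 6) walk_f) => // [|i lt_in].
  by rewrite def_n /= size_progression; lia.
have [-> | n2] := eqVneq i 2; first exact: Or32.
have [-> | n6] := eqVneq i 6; first exact: Or33.
apply: Or31.
have [le1 | gt1] := leqP i 1; last have [le5 | gt5] := leqP i 5.
- by apply: (dominates_near (j := 0)); [rewrite inE | lia].
- by apply: (dominates_near (j := 4)); [rewrite inE | lia].
have [lt_i | ge_i] := ltnP i.+1 (8 + 3 * m).
  apply: (dominates_sub (I := progression 8 m)) => [j Ij|].
    by rewrite !inE Ij !orbT.
  by apply: dominates_progression; lia.
by apply: (dominates_near (j := 0)); [rewrite inE | lia].
Qed.

(* The undominated vertex is [f 5]. *)
Lemma third_of_walk_chords m :
  #|G| = 3 * m + 8 -> adj (f 0) (f 4) -> adj (f 2) (f 6) -> third_isolating.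
Proof.
move=> def_n a04 a26.
apply: (third_of_dominates (I := [:: 0, 2 & progression 8 m])
  (a := 5) (b := 5) walk_f) => //.
- by rewrite def_n /= size_progression; lia.
- by rewrite adj_irrefl.
move=> i lt_in; have [-> | n5] := eqVneq i 5; first exact: Or32.
apply: Or31.
have [le6 | gt6] := leqP i 6.
  case: i le6 n5 {lt_in} => [|[|[|[|[|[|[]]]]]]] // _ _.
  - by apply: (dominates_near (j := 0)); [rewrite inE | lia].
  - by apply: (dominates_near (j := 0)); [rewrite inE | lia].
  - by apply: (dominates_near (j := 2)); [rewrite inE | lia].
  - by apply: (dominates_near (j := 2)); [rewrite inE | lia].
  - by exists 0; rewrite ?inE // orbC adj_sym a04.
  - by exists 2; rewrite ?inE // orbC adj_sym a26.
have [lt_i | ge_i] := ltnP i.+1 (8 + 3 * m).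
  apply: (dominates_sub (I := progression 8 m)) => [j Ij|].
    by rewrite !inE Ij !orbT.
  by apply: dominates_progression; lia.
by apply: (dominates_near (j := 0)); [rewrite inE | lia].
Qed.

Lemma third_of_walk_chord5 :
  #|G| = 5 -> adj (f 0) (f 2) || adj (f 0) (f 3) -> third_isolating.
Proof.
(* [f 0] dominates [f 1], [f 4] and the end of a chord; [u] is the one of 2 and 3 that it may
   miss. *)
move=> n5 chord; pose u := if adj (f 0) (f 2) then 3 else 2.
apply: (third_of_dominates (I := [:: 0]) (a := u) (b := u) walk_f) => //.
- by rewrite n5.
- by rewrite adj_irrefl.
rewrite n5 => -[|[|[|[|[]]]]] // _.
- by apply: Or31; apply: (dominates_near (j := 0)); [rewrite inE | lia].
- by apply: Or31; apply: (dominates_near (j := 0)); [rewrite inE | lia].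
- rewrite /u; case: ifP chord => [a02 _ | na02 _]; last exact: Or32.
  by apply: Or31; exists 0; rewrite ?inE // orbC adj_sym a02.
- rewrite /u; case: ifP chord => [a02 _ | na02 /= a03]; first exact: Or32.
  by apply: Or31; exists 0; rewrite ?inE // orbC adj_sym a03.
- by apply: Or31; apply: (dominates_near (j := 0)); [rewrite inE | lia].
Qed.

End HamiltonianWalk.

(** * Hamiltonian graphs with n = 2 modulo 3 *)

Lemma third_of_walk_large f m :
  hamiltonian_walk f -> #|G| = 3 * m + 8 -> third_isolating.
Proof.
move=> walk_f def_n.
have [a26 | n26] := boolP (adj (f 2) (f 6)); last first.
  exact: (third_of_walk_nonadj walk_f def_n).
(* The shift turns the index pairs 2, 6 and 4, 8 into 0, 4 and 2, 6. *)
have walk_f2 := hamiltonian_walk_shift 2 walk_f.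
have [a48 | n48] := boolP (adj (f 4) (f 8)); last first.
  exact: (third_of_walk_nonadj walk_f2 def_n).
exact: (third_of_walk_chords walk_f2 def_n).
Qed.

Lemma third_of_walk5 f :
    hamiltonian_walk f -> #|G| = 5 -> ~ isomorphic G (cycle_graph 5) -> third_isolating.
Proof.
move=> walk_f n5 nC5.
(* A chord joins indices 2 or 3 apart. The sums [2 + i] and [3 + i] match the walk shifted by [i] up
   to conversion. *)
have [/existsP[i /orP chord] | /existsPn nochord] :=
    boolP [exists i : 'I_5, adj (f i) (f (2 + i)) || adj (f i) (f (3 + i))].
  apply: (third_of_walk_chord5 (hamiltonian_walk_shift i walk_f) n5); exact/orP.
case: nC5; have [fS fn fsurj] := walk_f; rewrite n5 in fn fsurj.
pose g (i : 'I_5) := f i.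
have g_inj : injective g.
  (* Five values that reach all five vertices are distinct. *)
  suff /image_injP g_inj : #|image g 'I_5| == #|'I_5| by move=> i j; apply: g_inj.
  rewrite card_ord; apply/eqP/(etrans _ n5)/eq_card => x; rewrite inE.
  by have [i lt_i5 ->] := fsurj x; apply/mapP; exists (Ordinal lt_i5); rewrite ?mem_enum.
have [|h gK hK] := inj_card_bij g_inj; first by rewrite n5 card_ord.
have g_adj i j : adj (g i) (g j) = cycle_adj i j.
  have nadj k : k < 5 ->
      (adj (f k) (f (2 + k)) = false) * (adj (f k) (f (3 + k)) = false).
    move=> lt_k5; have := nochord (Ordinal lt_k5).
    by rewrite negb_or => /andP[/negbTE-> /negbTE->].
  have edge k : adj (f k.+1) (f k) by rewrite adj_sym.
  have e40 : adj (f 4) (f 0) by rewrite -(fn 0).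
  (* These are all five non-adjacent pairs of the pentagon; the discarded pair 2, 5 repeats 2, 0. *)
  have [[n02 n03] [n13 n14] [n24 _]] := And3 (nadj 0 isT) (nadj 1 isT) (nadj 2 isT).
  case: i j => [[|[|[|[|[|[]]]]]] ?] // [[|[|[|[|[|[]]]]]] ?] //;
    rewrite /g /cycle_adj /=;
    by rewrite ?adj_irrefl ?fS ?edge ?e40 ?n02 ?n03 ?n13 ?n14 ?n24 //
      adj_sym ?e40 ?n02 ?n03 ?n13 ?n14 ?n24.
exists h; split; first by exists g.
by move=> x y; rewrite -[in RHS](hK x) -[in RHS](hK y) g_adj.
Qed.

Lemma third_isolating_exists :
  connected_graph G -> 2 < #|G| -> ~ isomorphic G (cycle_graph 5) -> third_isolating.
Proof.
move=> conn n3 nC5; have [// | [f walk_f]] := third_or_hamiltonian conn n3.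
have [lt2 | ge2] := ltnP (#|G| %% 3) 2; first exact: (third_of_walk_mod3 walk_f).
have [n5 | n5] := eqVneq #|G| 5; first exact: (third_of_walk5 walk_f).
(* Here n is 2 modulo 3, exceeds 2 and differs from 5, so n >= 8. *)
apply: (@third_of_walk_large f ((#|G| - 8) %/ 3)) => //.
have := divn_eq #|G| 3; lia.
Qed.

End Bound.

(** * The bound n/3 and its sharpness *)

Theorem theorem3p1 :
  (forall G : sgraph,
      connected_graph G -> (3 <= #|G|)%N -> ~ isomorphic G (cycle_graph 5) ->
      ((isolation_number G)%:R : rat) <= #|G|%:R / 3%:R)
  /\
  (exists G : sgraph,
      [/\ connected_graph G, (3 <= #|G|)%N, ~ isomorphic G (cycle_graph 5)
        & ((isolation_number G)%:R : rat) = #|G|%:R / 3%:R]).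
Proof.
have bound (G : sgraph) : connected_graph G -> (3 <= #|G|)%N ->
    ~ isomorphic G (cycle_graph 5) -> (3 * isolation_number G <= #|G|)%N.
  move=> conn n3 nC5; have [S [isoS leS]] := third_isolating_exists conn n3 nC5.
  by apply: leq_trans leS; rewrite leq_mul2l (isolation_number_le isoS).
split=> [G conn n3 nC5 | ].
  by rewrite ler_pdivlMr ?ltr0n // -natrM ler_nat mulnC bound.
(* The triangle attains equality: the bound leaves at most one vertex, and the empty set is not
   isolating because the triangle has an edge. *)
have C3adj (x y : cycle_graph 3) : x != y -> adj x y.
  by case: x y => [[|[|[|]]] ?] // [[|[|[|]]] ?].
have C3conn : connected_graph (cycle_graph 3).
  by move=> x y; have [-> | /C3adj] := eqVneq x y; [exact: connect0 | exact: connect1].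
have cardC3 : #|cycle_graph 3| = 3 by exact: card_ord.
have C3nC5 : ~ isomorphic (cycle_graph 3) (cycle_graph 5).
  by case=> f [/bij_eq_card]; rewrite !card_ord.
have ge1 : (0 < isolation_number (cycle_graph 3))%N.
  rewrite /isolation_number; case: arg_minnP => [|S isoS _]; first exact: isolating_setT.
  rewrite lt0n cards_eq0; apply/negP=> /eqP S0.
  have out (x : cycle_graph 3) : x \in ~: closed_nbhd S.
    by rewrite !inE S0 inE; apply/exists_inPn=> y; rewrite inE.
  by move/forall_inP: isoS => /(_ ord0 (out _))/forall_inP/(_ ord_max (out _)).
exists (cycle_graph 3); split; rewrite ?cardC3 //.
have -> : isolation_number (cycle_graph 3) = 1%N.
  have := bound _ C3conn; rewrite cardC3 => /(_ isT C3nC5); lia.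
by rewrite divff // pnatr_eq0.
Qed.
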